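(* Let $p,q$ be distinct primes such that $q\not\equiv 1\pmod p$. Up to isomorphism, there is a unique left brace with additive group isomorphic to $\mathbb{Z}_p^2\times\mathbb{Z}_q$ and with $|\ker\lambda|=pq$. It is $(B,+,\circ)$ with $B=\mathbb{Z}_p\times\mathbb{Z}_p\times\mathbb{Z}_q$ and $$\begin{pmatrix} x_1\\ x_2\\ x_3\end{pmatrix}+\begin{pmatrix} y_1\\ y_2\\ y_3\end{pmatrix}=\begin{pmatrix} x_1+y_1\\ x_2+y_2\\ x_3+y_3\end{pmatrix},\qquad \begin{pmatrix} x_1\\ x_2\\ x_3\end{pmatrix}\circ\begin{pmatrix} y_1\\ y_2\\ y_3\end{pmatrix}=\begin{pmatrix} x_1+y_1+x_2y_2\\ x_2+y_2\\ x_3+y_3\end{pmatrix}$$ for all $x_1,x_2,y_1,y_2\in\mathbb{Z}_p$ and $x_3,y_3\in\mathbb{Z}_q$. In particular, $(B,\circ)\cong\mathbb{Z}_p^2\times\mathbb{Z}_q$.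
   Context: A skew (left) brace is a triple $(B,+,\circ)$ where $(B,+)$ and $(B,\circ)$ are groups such that $a\circ(b+c)=a\circ b-a+a\circ c$ for all $a,b,c\in B$; it is a left brace if $(B,+)$ is abelian. The map $\lambda:(B,\circ)\to\mathrm{Aut}(B,+)$, $\lambda_a(b)=-a+a\circ b$, is a group homomorphism, with kernel $\ker\lambda$. Isomorphisms are bijections preserving both operations. *)

(* Defs.v *)
From HB Require Import structures.
From mathcomp Require Import all_boot all_order all_algebra.
From mathcomp Require Import ring.
From mathcomp Require Import boolp classical_sets functions cardinality.

Set Implicit Arguments.
Unset Strict Implicit.
Unset Printing Implicit Defensive.

Import GRing.Theory.

Local Open Scope ring_scope.

(* (B,+) is the zmodType structure of B (so + is abelian); (B,o) is its
   groupType structure, with a o b written (a * b)%g. *)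
HB.mixin Record Zmodule_isLeftBrace B of GRing.Zmodule B & monoid.Group B := {
  brace_mulgDr : forall a b c : B, (a * (b + c))%g = (a * b)%g - a + (a * c)%g
}.

#[short(type="leftBraceType")]
HB.structure Definition LeftBrace :=
  {B of Zmodule_isLeftBrace B & GRing.Zmodule B & monoid.Group B}.

Definition lambda (B : leftBraceType) (a b : B) : B := - a + (a * b)%g.

Definition ker_lambda (B : leftBraceType) : set B :=
  [set a : B | forall b, lambda a b = b]%classic.
Arguments ker_lambda B : clear implicits.

Definition zmod_isom (U V : zmodType) : Prop :=
  exists f : {additive U -> V}, bijective f.

Definition brace_isom (B C : leftBraceType) : Prop :=
  exists f : B -> C, [/\ bijective f,
    {morph f : x y / x + y} & {morph f : x y / (x * y)%g}].

(* A copy of Z_p x Z_p x Z_q: the product type itself already carries a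
   groupType structure, namely its additive group. *)
Definition braceppq (p q : nat) : Type := ('Z_p * 'Z_p * 'Z_q)%type.

Section BracePPQ.
Variables p q : nat.
Local Notation B := (braceppq p q).

HB.instance Definition _ := GRing.Zmodule.copy B ('Z_p * 'Z_p * 'Z_q)%type.

Definition circ (x y : B) : B :=
  let: (x1, x2, x3) := x in let: (y1, y2, y3) := y in
  (x1 + y1 + x2 * y2, x2 + y2, x3 + y3).

Definition circ1 : B := (0, 0, 0).

Definition circV (x : B) : B :=
  let: (x1, x2, x3) := x in (x2 * x2 - x1, - x2, - x3).

Lemma circA : associative circ.
Proof.
by move=> [[x1 x2] x3] [[y1 y2] y3] [[z1 z2] z3] /=; congr (_, _, _); ring.
Qed.

Lemma circ1x : left_id circ1 circ.
Proof. by move=> [[x1 x2] x3] /=; congr (_, _, _); ring. Qed.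

Lemma circx1 : right_id circ1 circ.
Proof. by move=> [[x1 x2] x3] /=; congr (_, _, _); ring. Qed.

Lemma circVx : left_inverse circ1 circV circ.
Proof. by move=> [[x1 x2] x3] /=; congr (_, _, _); ring. Qed.

Lemma circxV : right_inverse circ1 circV circ.
Proof. by move=> [[x1 x2] x3] /=; congr (_, _, _); ring. Qed.

HB.instance Definition _ :=
  isGroup.Build B circA circ1x circx1 circVx circxV.

Lemma circDr (a b c : B) : (a * (b + c))%g = (a * b)%g - a + (a * c)%g.
Proof.
case: a b c => [[x1 x2] x3] [[y1 y2] y3] [[z1 z2] z3].
by congr (_, _, _) => /=; ring.
Qed.

HB.instance Definition _ := Zmodule_isLeftBrace.Build B circDr.

End BracePPQ.

(* Main.v *)
Require Import Defs.
(** The kernel K of lambda is closed under both operations, which agree on it.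
    By Cauchy's theorem it is cyclic, of order pq, so each lambda_a acts on it
    as multiplication by some m; as lambda_a^p = id and p is prime to q - 1,
    m = 1.  If e is a p-torsion element outside K, every element is k + j e
    with k in K, and for the same reason lambda_a(e) - e lies in K.  Put
    e1 = lambda_e(e) - e, which is nonzero, and let k generate the q-torsion
    of K; then lambda fixes e1 and k, and in the basis e1, e, k the circle
    operation has the required form.  Finally, p is odd, and
    (x1, x2, x3) |-> (x1 - x2^2 / 2, x2, x3) linearises the circle operation. *)
From HB Require Import structures.
From mathcomp Require Import all_boot all_order all_algebra all_fingroup.
From mathcomp Require Import cyclic pgroup.
From mathcomp Require Import classical_sets cardinality.
From mathcomp Require Import ring.

Set Implicit Arguments.
Unset Strict Implicit.
Unset Printing Implicit Defensive.

Import GRing.Theory.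

Local Open Scope ring_scope.

(** * Passage to finite braces and finite cardinals *)

HB.structure Definition FinLeftBrace := {B of LeftBrace B & Finite B}.

(* B is only known to be a leftBraceType; this alias of B carries the finite
   structure transported from T, giving access to finite group theory. *)
Definition finite_copy (B : leftBraceType) (T : finType) (f : B -> T)
  (g : T -> B) (fK : cancel f g) : Type := B.

Section FiniteCopy.
Variables (B : leftBraceType) (T : finType) (f : B -> T) (g : T -> B).
Hypothesis fK : cancel f g.
Local Notation C := (finite_copy fK).
HB.instance Definition _ := LeftBrace.copy C B.
HB.instance Definition _ : isCountable C := CanIsCountable fK.
HB.instance Definition _ : isFinite C :=
  CanIsFinite (fK : cancel (f : C -> T) g).
End FiniteCopy.

(** Links the classical-set cardinality used in the theorem to [#|A|], through the enumeration of
    [A]. *)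
Lemma finset_card_eqP (T : finType) (A : {set T}) n :
  reflect (#|A| = n) (card_eq [set x | x \in A]%classic `I_n).
Proof.
have cA : card_eq [set x | x \in A]%classic `I_#|A|.
  have -> : [set x | x \in A]%classic =
            (enum_val @` [set: 'I_#|A|])%classic.
    apply/seteqP; split=> x /= => [Ax|[i _ <-]]; last exact: enum_valP.
    by exists (enum_rank_in Ax x) => //; rewrite enum_rankK_in.
  rewrite (card_eql (inj_card_eq _)); last exact: in2W enum_val_inj.
  by rewrite card_eq_sym; exact: card_II.
by rewrite (card_eql cA); exact: card_eq_II.
Qed.

(** * The action [lambda] by additive maps *)

Section Lambda.
Variable B : leftBraceType.
Implicit Types a b c : B.

Lemma lambdaE a b : (a * b)%g = a + lambda a b.
Proof. by rewrite /lambda addrA subrr add0r. Qed.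

Fact lambda_is_nmod_morphism a : nmod_morphism (lambda a).
Proof.
(* The brace axiom at [b = c = 0] forces [a * 0 = a]. *)
have mulg0 : (a * 0)%g = a.
  apply/subr0_eq/(addIr (a * 0)%g).
  by rewrite add0r -brace_mulgDr addr0.
split=> [|b c]; rewrite /lambda; first by rewrite mulg0 addNr.
by rewrite brace_mulgDr !addrA.
Qed.

HB.instance Definition _ a :=
  GRing.isNmodMorphism.Build B B (lambda a) (lambda_is_nmod_morphism a).

Lemma brace_one : 1%g = 0 :> B.
Proof. by apply: (mulgI 1%g); rewrite mulg1 lambdaE raddf0 addr0. Qed.

Lemma lambdaM a b c : lambda (a * b)%g c = lambda a (lambda b c).
Proof.
apply: (addrI (a * b)%g); rewrite -lambdaE -mulgA [(b * c)%g]lambdaE.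
by rewrite brace_mulgDr [(a * lambda b c)%g]lambdaE addrA subrK.
Qed.

Lemma lambda1 b : lambda 1%g b = b.
Proof. by rewrite /lambda mul1g brace_one oppr0 add0r. Qed.

End Lambda.

(** * Multiples of torsion elements in an abelian group *)

Section Multiples.
Variable V : zmodType.
Implicit Type v : V.

Lemma mulrn_eqmod v n i j : v *+ n = 0 -> i = j %[mod n] -> v *+ i = v *+ j.
Proof.
move=> vn0 eq_ij; rewrite (divn_eq i n) (divn_eq j n) eq_ij.
by rewrite !mulrnDr ![(_ * n)%N]mulnC !mulrnA vn0 !mul0rn.
Qed.

(** Coefficients in ['Z_n] act on [n]-torsion elements; [1 < n] ensures that ['Z_n] really has
    modulus [n]. *)
Lemma mulrn_Zp_add v n (i j : 'Z_n) : (1 < n)%N -> v *+ n = 0 ->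
  v *+ (i + j : 'Z_n)%R = v *+ i + v *+ j.
Proof.
move=> n_gt1 vn0; rewrite -mulrnDr; apply: (mulrn_eqmod vn0) => /=.
by rewrite [X in (_ %% X %% _)%N]Zp_cast // modn_mod.
Qed.

Lemma mulrn_Zp_mul v n (i j : 'Z_n) : (1 < n)%N -> v *+ n = 0 ->
  v *+ (i * j : 'Z_n)%R = v *+ i *+ j.
Proof.
move=> n_gt1 vn0; rewrite -mulrnA; apply: (mulrn_eqmod vn0) => /=.
by rewrite [X in (_ %% X %% _)%N]Zp_cast // modn_mod.
Qed.

Lemma mulrn_coprime_eq0 v m n :
  coprime m n -> v *+ m = 0 -> v *+ n = 0 -> v = 0.
Proof.
move=> /eqP co vm vn; case: (posnP m) => [m0|m_gt0].
  by move: co vn; rewrite m0 gcd0n => ->.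
have [km kn e _] := egcdnP n m_gt0.
have: v *+ (km * m) = v *+ (kn * n + gcdn m n) by rewrite e.
by rewrite co mulrnDr !(mulnC _ m, mulnC _ n) !mulrnA vm vn !mul0rn add0r.
Qed.

End Multiples.

(** * The kernel of [lambda] in a finite brace *)

Section FiniteBrace.
Variable B : FinLeftBrace.type.
Implicit Types a b k x y : B.

Definition kerL : {set B} := [set a : B | [forall b, lambda a b == b]].

Lemma kerLP a : reflect (forall b, lambda a b = b) (a \in kerL).
Proof. by rewrite inE; apply: (iffP 'forall_eqP). Qed.

Fact kerL_group_set : group_set kerL.
Proof.
apply/group_setP; split=> [|a b /kerLP Ka /kerLP Kb]; apply/kerLP=> x.
  exact: lambda1.
by rewrite lambdaM Kb Ka.
Qed.
Canonical kerL_group := Group kerL_group_set.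

Lemma kerL_mulg k b : k \in kerL -> (k * b)%g = k + b.
Proof. by move=> /kerLP Kk; rewrite lambdaE Kk. Qed.

Lemma kerL_expg k n : k \in kerL -> (k ^+ n)%g = k *+ n.
Proof.
move=> Kk; elim: n => [|n IHn]; first exact: brace_one.
by rewrite expgS mulrS kerL_mulg // IHn.
Qed.

Lemma kerL_add k k' : k \in kerL -> k' \in kerL -> k + k' \in kerL.
Proof. by move=> Kk Kk'; rewrite -kerL_mulg // groupM. Qed.

Lemma kerL_opp k : k \in kerL -> - k \in kerL.
Proof.
move=> Kk; have -> : - k = (k^-1)%g; last by rewrite groupV.
by apply: (addrI k); rewrite subrr -kerL_mulg // mulgV brace_one.
Qed.

Lemma kerL_mulrn k n : k \in kerL -> k *+ n \in kerL.
Proof. by move=> Kk; rewrite -kerL_expg // groupX. Qed.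

Lemma kerL_normal : (kerL <| [set: B])%g.
Proof.
apply/normalP; split=> [|a _]; first exact: finset.subsetT.
apply/eqP; rewrite eqEcard cardJg leqnn andbT.
apply/fintype.subsetP=> _ /imsetP[k /kerLP Kk ->].
by apply/kerLP=> b; rewrite !lambdaM Kk -lambdaM mulVg lambda1.
Qed.

(** Since the conjugate of [k] by [a] in the circle group lies in the kernel, its circle product
    with [a] is a sum; hence [lambda a k] is that conjugate, and normality applies. *)
Lemma lambda_kerL a k : k \in kerL -> lambda a k \in kerL.
Proof.
move=> Kk; have Kk' : (k ^ a^-1)%g \in kerL.
  by rewrite memJ_norm // (fintype.subsetP (normal_norm kerL_normal)) ?inE.
suff -> : lambda a k = (k ^ a^-1)%g by [].
apply: (addrI a); rewrite -lambdaE addrC -kerL_mulg //.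
by rewrite conjgE invgK mulgA mulgKV.
Qed.

Lemma lambda_expg a n b : lambda (a ^+ n)%g b = iter n (lambda a) b.
Proof.
by elim: n => [|n IHn]; rewrite ?lambda1 // expgS lambdaM IHn.
Qed.

(** In the quotient of the circle group by the kernel, the order of [a] divides the index. *)
Lemma iter_lambda_index a b : iter #|[set: B] : kerL|%g (lambda a) b = b.
Proof.
rewrite -lambda_expg.
suff /kerLP-> : (a ^+ #|[set: B] : kerL|%g)%g \in kerL by [].
have Na : (a \in 'N(kerL))%g.
  by rewrite (fintype.subsetP (normal_norm kerL_normal)) ?inE.
apply: coset_idr; rewrite ?groupX // morphX //=.
rewrite -card_quotient ?normal_norm ?kerL_normal //.
by rewrite expg_cardG // mem_quotient ?inE.
Qed.

End FiniteBrace.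

(** * Residues modulo a prime *)

Lemma expn_coprime_eq1 r m n : prime r -> coprime n r.-1 -> (0 < n)%N ->
  m ^ n = 1 %[mod r] -> m = 1 %[mod r].
Proof.
move=> r_pr co n_gt0 mn1.
(* As [m ^ n = 1] with [n > 0], [m] is prime to [r] and Fermat applies. *)
have fermat : m ^ r.-1 = 1 %[mod r].
  rewrite -totient_prime //; apply: Euler_exp_totient.
  rewrite -(coprime_pexpl _ _ n_gt0) -coprime_modl mn1.
  by rewrite coprime_modl coprime1n.
(* Bezout combines the coprime exponents [n] and [r.-1] into exponent 1. *)
have [u v e _] := egcdnP r.-1 n_gt0.
have: m ^ (u * n) = m ^ (v * r.-1 + gcdn n r.-1) %[mod r] by rewrite e.
rewrite (eqP co) expnD expn1 mulnC (mulnC v) !expnM -modnXm mn1 modnXm exp1n.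
by rewrite -modnMml -modnXm fermat modnXm exp1n modnMml mul1n => ->.
Qed.

Lemma Zp_dvd_eq0 n (x : 'Z_n) : (1 < n)%N -> (n %| x)%N -> x = 0.
Proof.
move=> n_gt1 nx; apply/val_inj => /=.
have := ltn_ord x; rewrite [X in (_ < X)%N]Zp_cast //.
by case: (posnP x) => // x_gt0; rewrite ltnNge dvdn_leq.
Qed.

(** * Classification, given a [p]-torsion element [e] outside the kernel *)

Section Classification.
Variables (B : FinLeftBrace.type) (p q : nat).
Hypotheses (p_pr : prime p) (q_pr : prime q) (p_neq_q : p <> q).
Hypothesis q_not1 : (q != 1 %[mod p])%N.
Hypotheses (cardB : #|B| = (p * p * q)%N) (cardK : #|kerL B| = (p * q)%N).
Variable e : B.
Hypotheses (Ke : e \notin kerL B) (ep0 : e *+ p = 0).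
Implicit Types a b x y : B.

Let p_gt0 : (0 < p)%N. Proof. exact: prime_gt0. Qed.
Let q_gt0 : (0 < q)%N. Proof. exact: prime_gt0. Qed.
Let p_gt1 : (1 < p)%N. Proof. exact: prime_gt1. Qed.
Let q_gt1 : (1 < q)%N. Proof. exact: prime_gt1. Qed.

Let co_pq : coprime p q.
Proof. by rewrite prime_coprime // dvdn_prime2 //; apply/eqP. Qed.

Let indexK : #|[set: B] : kerL B|%g = p.
Proof.
rewrite -divgS ?finset.subsetT //= cardsT cardB cardK -mulnA.
by rewrite mulnK // muln_gt0 p_gt0.
Qed.

(** Elements of orders [p] and [q] commute because the circle operation on the kernel is addition,
    so their product has order [p * q]. *)
Lemma kerL_generator : exists2 w, w \in kerL B & #[w]%g = (p * q)%N.
Proof.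
have [x Kx ox] : {x : B | x \in kerL B & #[x]%g = p}.
  by apply: (@Cauchy _ _ (kerL_group B)) => //=; rewrite cardK dvdn_mulr.
have [y Ky oy] : {y : B | y \in kerL B & #[y]%g = q}.
  by apply: (@Cauchy _ _ (kerL_group B)) => //=; rewrite cardK dvdn_mull.
exists (x * y)%g; first exact: groupM.
rewrite -[in RHS]ox -[in RHS]oy; apply: orderM; last by rewrite ox oy.
by rewrite /commute !kerL_mulg // addrC.
Qed.

Lemma mulrn_generator w x : w \in kerL B -> #[w]%g = (p * q)%N ->
  x \in kerL B -> exists n, x = w *+ n.
Proof.
move=> Kw ow Kx.
have eK : kerL B = <[w]>%g.
  by apply/esym/eqP; rewrite eqEcard cycle_subG Kw -orderE ow cardK leqnn.
move: Kx; rewrite eK => /cycleP[n ->]; exists n; exact: kerL_expg.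
Qed.

Lemma mulrn_generator_eqmod w i j : w \in kerL B -> #[w]%g = (p * q)%N ->
  w *+ i = w *+ j -> i = j %[mod p * q].
Proof.
move=> Kw ow wij; apply/eqP.
by rewrite -ow -eq_expg_mod_order !kerL_expg // wij.
Qed.

Lemma iter_mulrn a x m n :
  lambda a x = x *+ m -> iter n (lambda a) x = x *+ (m ^ n).
Proof.
move=> ax; elim: n => //= n ->.
by rewrite raddfMn /= ax -mulrnA expnS.
Qed.

Lemma lambda_id_kerL a x : x \in kerL B -> lambda a x = x.
Proof.
move=> Kx; have [w Kw ow] := kerL_generator.
suff wE : lambda a w = w.
  by have [n ->] := mulrn_generator Kw ow Kx; rewrite raddfMn /= wE.
have [m am] := mulrn_generator Kw ow (lambda_kerL a Kw).
have w_pq : w *+ (p * q) = 0.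
  by rewrite -kerL_expg // -ow expg_order brace_one.
have : w *+ (m ^ p) = w *+ 1.
  by rewrite -(iter_mulrn _ am) -indexK iter_lambda_index.
move=> /(mulrn_generator_eqmod Kw ow)/eqP.
(* By Chinese remainders, [m = 1] is checked modulo [p], where the exponent [p] is prime to [p - 1],
   and modulo [q], where it is prime to [q - 1] by [q_not1]. *)
rewrite chinese_remainder // => /andP[/eqP mp /eqP mq].
rewrite am -[RHS]mulr1n; apply/(mulrn_eqmod w_pq)/eqP.
rewrite chinese_remainder //; apply/andP; split; apply/eqP.
  by apply: (expn_coprime_eq1 _ _ p_gt0 mp); rewrite ?coprimenP.
apply: (expn_coprime_eq1 _ _ p_gt0 mq); rewrite ?prime_coprime //.
by apply: contra q_not1 => pq1; rewrite eqn_mod_dvd // subn1.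
Qed.

(** If [n] were prime to [p], Bezout would recover [e] as a multiple of [e *+ n], putting [e] in the
    kernel. *)
Lemma dvdn_mulrn_kerL n : e *+ n \in kerL B -> (p %| n)%N.
Proof.
move=> Ken; apply: contraR Ke; rewrite -prime_coprime // => co_pn.
have n_gt0 : (0 < n)%N.
  rewrite lt0n; apply: contraTneq co_pn => ->.
  by rewrite /coprime gcdn0 gtn_eqF.
have [u v uv _] := egcdnP p n_gt0.
suff -> : e = e *+ n *+ u by exact: kerL_mulrn.
rewrite -mulrnA mulnC uv gcdnC (eqP co_pn) mulrnDr mulnC mulrnA ep0.
by rewrite mul0rn add0r.
Qed.

Lemma mulrn_kerL_eqmod k i j : k \in kerL B -> e *+ i = k + e *+ j ->
  i = j %[mod p].
Proof.
move=> Kk eij; apply/eqP.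
(* The natural number [p.-1 * j] plays the role of [- j], since [e *+ p = 0]. *)
have: e *+ (i + p.-1 * j) \in kerL B.
  rewrite mulrnDr eij -addrA -mulrnDr -mulSn prednK // mulrnA ep0 mul0rn.
  by rewrite addr0.
move=> /dvdn_mulrn_kerL; rewrite -(eqn_modDr (p.-1 * j) i) -mulSn prednK //.
by rewrite modnMr.
Qed.

(** By counting: the sums with [j < p] are pairwise distinct, and there are [p * q * p] of them, as
    many as elements of [B]. *)
Lemma kerL_decomposition x :
  exists2 k, k \in kerL B & exists j, x = k + e *+ j.
Proof.
pose S := finset.setX (kerL B) [set: 'I_p].
pose h (u : B * 'I_p) := u.1 + e *+ u.2.
have inj_h : {in S &, injective h}.
  move=> [k i] [k' j]; rewrite !finset.in_setX !finset.in_setT /= !andbT.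
  move=> Kk Kk' eq_h.
  have eij : i = j.
    apply/val_inj; rewrite /= -[LHS](modn_small (ltn_ord i)).
    rewrite -[RHS](modn_small (ltn_ord j)).
    apply: (@mulrn_kerL_eqmod (k' - k)); first by rewrite kerL_add ?kerL_opp.
    have {}eq_h : k + e *+ i = k' + e *+ j := eq_h.
    by apply: (addrI k); rewrite eq_h addrA [k + _]addrC subrK.
  by move: eq_h; rewrite eij /h /= => /addIr->.
have : h @: S == [set: B]%SET.
  rewrite eqEcard finset.subsetT card_in_imset // cardsX !cardsT card_ord.
  by rewrite cardK cardB mulnAC leqnn.
move=> /eqP/setP/(_ x); rewrite finset.in_setT => /imsetP[[k j]].
rewrite finset.in_setX finset.in_setT andbT /= => Kk ->.
by exists k => //; exists j.
Qed.

(** Modulo the kernel, [lambda a] multiplies [e] by some [j]; iterating [p] times gives [j ^ p = 1]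
    modulo [p], hence [j = 1]. *)
Lemma lambda_sub_kerL a : lambda a e - e \in kerL B.
Proof.
have [k Kk [j aj]] := kerL_decomposition (lambda a e).
have iterE n :
    exists2 k', k' \in kerL B & iter n (lambda a) e = k' + e *+ (j ^ n).
  elim: n => [|n [k' Kk' /= ->]].
    by exists 0; rewrite ?add0r // -brace_one group1.
  exists (k' + k *+ (j ^ n)); first by rewrite kerL_add ?kerL_mulrn.
  rewrite raddfD /= lambda_id_kerL // raddfMn /= aj mulrnDl -mulrnA -expnS.
  by rewrite addrA.
have [k' Kk'] := iterE p; rewrite -{1}indexK iter_lambda_index => ek'.
have /esym jp := mulrn_kerL_eqmod (i := 1) Kk' ek'.
have j1 : j = 1 %[mod p].
  by apply: (expn_coprime_eq1 _ _ p_gt0 jp); rewrite ?coprimenP.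
by rewrite aj (mulrn_eqmod ep0 j1) addrK.
Qed.

(** [k + b] is also the circle product of [k] and [b]. *)
Lemma lambda_addl k b x : k \in kerL B -> lambda (k + b) x = lambda b x.
Proof. by move=> Kk; rewrite -kerL_mulg // lambdaM; move/kerLP: Kk => ->. Qed.

Lemma lambda_translation : exists e1,
  [/\ e1 \in kerL B, e1 *+ p = 0, e1 <> 0 & lambda e e = e + e1].
Proof.
exists (lambda e e - e); split=> [|||]; last by rewrite addrC subrK.
- exact: lambda_sub_kerL.
- by rewrite mulrnBl -raddfMn ep0 raddf0 subr0.
(* If [lambda e] fixed [e], it would fix the kernel and [e], hence everything, against [Ke]. *)
move=> /subr0_eq ee; case/negP: Ke; apply/kerLP=> x.
have [k Kk [j ->]] := kerL_decomposition x.
by rewrite raddfD raddfMn /= ee lambda_id_kerL.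
Qed.

Lemma lambda_mulrn e1 n : e1 \in kerL B -> lambda e e = e + e1 ->
  lambda (e *+ n) e = e + e1 *+ n.
Proof.
move=> Ke1 lambda_e; elim: n => [|n IHn].
  by rewrite !mulr0n addr0 -brace_one lambda1.
rewrite -(@lambda_addl (e1 *+ n)) ?kerL_mulrn //.
(* Up to the kernel, [e *+ n.+1] is the circle product of [e] and [e *+ n], so the induction step
   becomes a composition. *)
have -> : e1 *+ n + e *+ n.+1 = (e * (e *+ n))%g.
  rewrite lambdaE raddfMn /= lambda_e mulrnDl mulrS addrCA.
  by rewrite [e1 *+ n + _]addrC.
rewrite lambdaM IHn raddfD raddfMn /= lambda_e lambda_id_kerL //.
by rewrite mulrS addrA.
Qed.

Lemma brace_isom_braceppq : brace_isom B (braceppq p q).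
Proof.
have [e1 [Ke1 e1p e1_neq0 lambda_e]] := lambda_translation.
have [w Kw ow] := kerL_generator.
have w_pq : w *+ (p * q) = 0.
  by rewrite -kerL_expg // -ow expg_order brace_one.
(* As [w] has order [p * q], this element has order [q]. *)
pose k3 := w *+ p.
have Kk3 : k3 \in kerL B by exact: kerL_mulrn.
have k3q : k3 *+ q = 0 by rewrite -mulrnA.
pose h (x : 'Z_p * 'Z_p * 'Z_q) : B := e1 *+ x.1.1 + e *+ x.1.2 + k3 *+ x.2.
have hD : {morph h : x y / x + y}.
  move=> [[x1 x2] x3] [[y1 y2] y3]; rewrite /h /= !mulrn_Zp_add //.
  by rewrite [e1 *+ _ + _ + (_ + _)]addrACA [LHS]addrACA.
(* The [e]-coordinate is detected modulo the kernel; the other two separate because [e1] and [k3]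
   are killed by the coprime [p] and [q]. *)
have h_eq0 (x : 'Z_p * 'Z_p * 'Z_q) : h x = 0 -> x = 0.
  case: x => [[x1 x2] x3]; rewrite /h /= => h0.
  have x20 : x2 = 0.
    apply: (Zp_dvd_eq0 p_gt1); apply: dvdn_mulrn_kerL.
    have -> : e *+ x2 = - (e1 *+ x1 + k3 *+ x3).
      by apply/eqP; rewrite -addr_eq0 addrCA addrA h0.
    by rewrite kerL_opp ?kerL_add ?kerL_mulrn.
  move: h0; rewrite x20 addr0 => /eqP; rewrite addr_eq0 => /eqP h0.
  have x10 : e1 *+ x1 = 0.
    apply: (mulrn_coprime_eq0 co_pq); first by rewrite mulrnAC e1p mul0rn.
    by rewrite h0 mulNrn mulrnAC k3q mul0rn oppr0.
  move/esym: h0; rewrite x10 => /eqP; rewrite oppr_eq0 => /eqP x30.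
  congr (_, _, _) => //.
    apply: (Zp_dvd_eq0 p_gt1); apply: contra_notT e1_neq0 => px1.
    by apply: (mulrn_coprime_eq0 _ e1p x10); rewrite prime_coprime.
  apply: (Zp_dvd_eq0 q_gt1).
  have: w *+ (p * x3) = w *+ 0 by rewrite mulrnA.
  move=> /(mulrn_generator_eqmod Kw ow)/eqP; rewrite mod0n -/(dvdn _ _).
  by rewrite dvdn_pmul2l.
have h_inj : injective h.
  move=> x y hxy; apply: subr0_eq; apply: h_eq0.
  by apply: (addIr (h y)); rewrite -hD subrK add0r.
have h_bij : bijective h.
  by apply: inj_card_bij => //; rewrite !card_prod !card_ord !Zp_cast // cardB.
have hM (x y : braceppq p q) : h (circ x y) = (h x * h y)%g.
  case: x y => [[x1 x2] x3] [[y1 y2] y3].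
  (* The [e1] and [k3] parts lie in the kernel, so only [x2] acts; this is the source of the term
     [x2 * y2]. *)
  have hx : lambda (h (x1, x2, x3)) e = e + e1 *+ x2.
    rewrite /h addrAC lambda_addl ?(lambda_mulrn _ Ke1) //.
    by rewrite kerL_add ?kerL_mulrn.
  have hE z1 z2 z3 : h (z1, z2, z3) = e1 *+ z1 + e *+ z2 + k3 *+ z3 by [].
  rewrite lambdaE [in lambda _ _]hE !raddfD !raddfMn /= hx !lambda_id_kerL //.
  rewrite /circ !hE !mulrn_Zp_add // mulrn_Zp_mul // mulrnDl.
  by rewrite [LHS](AC (3*2*2) ((1*4*6)*(2*(5*3)*7))).
have [h' hK h'K] := h_bij.
exists (h' : B -> braceppq p q); split; first by exists h.
- by move=> x y; apply: h_inj; rewrite hD !h'K.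
- by move=> x y; apply: h_inj; rewrite [in RHS]hM !h'K.
Qed.

End Classification.

(** * A [p]-torsion element outside the kernel *)

Lemma p_torsion_notin_kerL (B : FinLeftBrace.type) (p q : nat)
    (f : {additive B -> 'Z_p * 'Z_p * 'Z_q}) :
  prime p -> prime q -> p <> q -> bijective f ->
  #|kerL B| = (p * q)%N ->
  exists2 e : B, e \notin kerL B & e *+ p = 0.
Proof.
move=> p_pr q_pr p_neq_q [g fK gK] cardK.
have p0 (x : 'Z_p) : x *+ p = 0.
  by rewrite -mulr_natr pchar_Zp ?prime_gt1 // mulr0.
have torsion (x1 x2 : 'Z_p) : g (x1, x2, 0) *+ p = 0.
  (* [g] is not declared additive, so torsion is checked through the injective [f]. *)
  apply: (can_inj fK); rewrite raddf0 raddfMn /= gK.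
  have -> n : (x1, x2, 0 : 'Z_q) *+ n = (x1 *+ n, x2 *+ n, 0).
    elim: n => // n IHn; rewrite !mulrS IHn.
    by congr (_, _, _); rewrite /= addr0.
  by rewrite !p0.
(* The kernel is cyclic, so it cannot contain both coordinate vectors of the [p]-torsion. *)
have [Ka|] := boolP (g (1, 0, 0) \in kerL B); last by exists (g (1, 0, 0)).
have [Kb|] := boolP (g (0, 1, 0) \in kerL B); last by exists (g (0, 1, 0)).
have [w Kw ow] := kerL_generator p_pr q_pr p_neq_q cardK.
have [m wm] := mulrn_generator cardK Kw ow Ka.
have [n wn] := mulrn_generator cardK Kw ow Kb.
have m1 : (f w).1.1 *+ m = 1 by rewrite -!raddfMn /= -wm gK.
have m2 : (f w).1.2 *+ m = 0 by rewrite -!raddfMn /= -wm gK.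
have n2 : (f w).1.2 *+ n = 1 by rewrite -!raddfMn /= -wn gK.
(* With [w1], [w2] the first coordinates of [f w], [1 = (m w1)(n w2) = (n w1)(m w2) = 0]. *)
have /eqP[] := oner_neq0 'Z_p.
by rewrite -[LHS]mulr1 -{1}m1 -n2 mulrnAl -mulrnAr mulrnAC m2 mul0rn mulr0.
Qed.

(** * The model brace: additive group, kernel and circle group *)

Lemma additive_isom_braceppq (p q : nat) :
  zmod_isom (braceppq p q) ('Z_p * 'Z_p * 'Z_q)%type.
Proof.
by exists (idfun : {additive braceppq p q -> braceppq p q}); exists id.
Qed.

Lemma card_ker_lambda_braceppq (p q : nat) : (1 < p)%N -> (1 < q)%N ->
  card_eq (ker_lambda (braceppq p q)) `I_(p * q).
Proof.
move=> p_gt1 q_gt1.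
pose K := finset.setX (finset.setX [set: 'Z_p] [set 0%R : 'Z_p]) [set: 'Z_q].
have -> : ker_lambda (braceppq p q) = [set x | x \in K]%classic.
  apply/seteqP; split=> -[[x1 x2] x3] /=.
    (* The first coordinate of [lambda x (0, 1, 0)] is [x2], so membership in the kernel forces
       [x2 = 0]. *)
    move=> /(_ (0, 1, 0))/(congr1 (fun u => u.1.1)) /=.
    rewrite addr0 mulr1 addKr => ->.
    by rewrite !finset.in_setX !finset.in_setT finset.in_set1 eqxx.
  rewrite !finset.in_setX !finset.in_setT finset.in_set1 /= andbT.
  move=> /eqP -> [[y1 y2] y3].
  by congr (_, _, _) => /=; rewrite ?mul0r ?addr0 addKr.
apply/finset_card_eqP; rewrite !cardsX !cardsT !card_ord cards1 muln1.
by rewrite !Zp_cast.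
Qed.

Lemma circ_group_isom (p q : nat) : (1 < p)%N -> odd p ->
  exists f : braceppq p q -> 'Z_p * 'Z_p * 'Z_q,
    bijective f /\ {morph f : x y / (x * y)%g >-> x + y}.
Proof.
move=> p_gt1 p_odd.
have two_unit : (2%:R : 'Z_p) \is a GRing.unit by rewrite unitZpE // coprimen2.
pose c : 'Z_p := 2%:R^-1.
have c2 : c * 2%:R = 1 by rewrite mulVr.
exists (fun x => (x.1.1 - c * x.1.2 ^+ 2, x.1.2, x.2)); split.
  exists (fun x => (x.1.1 + c * x.1.2 ^+ 2, x.1.2, x.2)) => -[[x1 x2] x3] /=.
    by rewrite subrK.
  by rewrite addrK.
move=> [[x1 x2] x3] [[y1 y2] y3]; congr (_, _, _) => /=.
(* Written with the factor [c * 2], [x2 * y2] is the cross term of [c * (x2 + y2) ^+ 2]. *)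
by rewrite -[x2 * y2]mul1r -c2; ring.
Qed.

(** * Uniqueness and the final assembly *)

Lemma unique_braceppq (p q : nat) (B : leftBraceType) :
  prime p -> prime q -> p <> q -> (q != 1 %[mod p])%N ->
  zmod_isom B ('Z_p * 'Z_p * 'Z_q)%type ->
  card_eq (ker_lambda B) `I_(p * q) ->
  brace_isom B (braceppq p q).
Proof.
move=> p_pr q_pr p_neq_q q_not1 [f [g fK gK]] cardK.
(* The additive isomorphism [f] is the injection that makes [B] finite. *)
pose C : FinLeftBrace.type := finite_copy fK.
have cardC : #|C| = (p * p * q)%N.
  rewrite (bij_eq_card (Bijective fK gK : bijective (f : C -> _))).
  by rewrite !card_prod !card_ord !Zp_cast ?prime_gt1.
have {}cardK : #|kerL C| = (p * q)%N.
  apply/finset_card_eqP.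
  suff -> : [set x | x \in kerL C]%classic = ker_lambda B by [].
  by apply/seteqP; split=> x; [move/kerLP | move/(kerLP (B := C))].
have f_bij : bijective (f : {additive C -> _}) by exists g.
have [e Ke ep] := p_torsion_notin_kerL p_pr q_pr p_neq_q f_bij cardK.
exact: (brace_isom_braceppq p_pr q_pr p_neq_q q_not1 cardC cardK Ke ep).
Qed.

Local Open Scope ring_scope.
Local Open Scope classical_set_scope.
Local Open Scope card_scope.

Theorem theorem3p6 (p q : nat) (p_prime : prime p) (q_prime : prime q)
    (p_neq_q : p <> q) (q_not1 : (q != 1 %[mod p])%N) :
  [/\ zmod_isom (braceppq p q) ('Z_p * 'Z_p * 'Z_q)%type,
      ker_lambda (braceppq p q) #= `I_(p * q),
      forall B : leftBraceType,
        zmod_isom B ('Z_p * 'Z_p * 'Z_q)%type ->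
        ker_lambda B #= `I_(p * q) ->
        brace_isom B (braceppq p q)
    & exists f : braceppq p q -> 'Z_p * 'Z_p * 'Z_q,
        bijective f /\ {morph f : x y / (x * y)%g >-> x + y}].
Proof.
split.
- exact: additive_isom_braceppq.
- by apply: card_ker_lambda_braceppq; apply: prime_gt1.
- by move=> B; apply: unique_braceppq.
apply: circ_group_isom; first exact: prime_gt1.
(* If [p = 2], the distinct prime [q] is odd, hence 1 modulo [p], against [q_not1]. *)
have [p2|//] := even_prime p_prime.
have [q2|q_odd] := even_prime q_prime; first by rewrite p2 q2 in p_neq_q.
by move: q_not1; rewrite p2 !modn2 q_odd.
Qed.
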